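(* Let $\alpha$ be an action of a discrete group $G$ on a locally compact Hausdorff space $X$. Then $$\operatorname{asdim}(X,\mathcal{E}_\alpha)\leq\dim_{\mathrm{LTC}}(\alpha).$$
   Context: $\Subset$ means compact subset (finite subset in a discrete group). Dimensions may be $\infty$. Coarse structure: a collection $\mathcal{E}$ of subsets (''controlled sets'') of $X\times X$ containing the diagonal $\Delta_X$ and closed under subsets, inverses, compositions and finite unions. $\operatorname{asdim}(X,\mathcal{E})$ is the infimum of all nonnegative integers $d$ such that for any $E\in\mathcal{E}$ there is a cover $\mathcal{W}=\mathcal{W}^{(0)}\cup\dots\cup\mathcal{W}^{(d)}$ of $X$ with $\bigcup_{W\in\mathcal{W}}W\times W\in\mathcal{E}$ and with $E\cap(W\times W')=\varnothing$ for any two different $W,W'\in\mathcal{W}^{(l)}$, $l=0,\dots,d$. Orbit coarse structure: for $K\Subset X$ and $L\Subset G$ let $E_{K,L}=\{(\alpha_g(x),x)\colon g\in L,\ x\in K,\ \alpha_g(x)\in K\}$; then $\mathcal{E}_\alpha=\{E\subseteq E_{K,L}\cup\Delta_X\colon K\Subset X,\ L\Subset G\}$. Long thin covering dimension: write $\alpha_L(x)=\{\alpha_g(x)\colon g\in L\}$, and let $\operatorname{mult}(\mathcal{U})=\sup_{x\in X}|\{U\in\mathcal{U}\colon x\in U\}|$. $\dim_{\mathrm{LTC}}(\alpha)$ is the infimum of all natural numbers $d$ satisfying: for any finite $L\Subset G$ and any compact $K\Subset X$ there is a natural number $N$ such that for any finite open cover $\mathcal{V}$ of $X$ there exist a collection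 $\mathcal{U}$ of open sets in $X$ and locally constant functions $\Lambda_U\colon U\to X$ ($U\in\mathcal{U}$) satisfying: (Lo) for any $x\in K$ there is $U\in\mathcal{U}$ with $\alpha_L(x)\subseteq U$; (Mu) $\operatorname{mult}(\mathcal{U})\leq d+1$; (Eq) for any $U\in\mathcal{U}$, $x\in U$, $g\in L$, if $\alpha_g(x)\in U$ then $\Lambda_U(\alpha_g(x))=\alpha_g(\Lambda_U(x))$; (Th) for any $U\in\mathcal{U}$ and $y\in\Lambda_U(U)$ there is $V\in\mathcal{V}$ with $\Lambda_U^{-1}(y)\cup\{y\}\subseteq V$; (Ca) $|\Lambda_U(U)|\leq N$ for any $U\in\mathcal{U}$. *)

(* Defs.v *)
From HB Require Import structures.
From mathcomp Require Import all_boot all_order all_algebra.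
From mathcomp Require Import all_classical all_reals all_analysis.

Set Implicit Arguments.
Unset Strict Implicit.
Unset Printing Implicit Defensive.

Import Order.TTheory GRing.Theory Num.Theory.

Local Open Scope classical_set_scope.
Local Open Scope ring_scope.
Local Open Scope card_scope.
Local Open Scope ereal_scope.

(* Dimensions are extended natural numbers, viewed inside the extended reals;
   the infimum is +oo when no natural number satisfies [P]. *)
Definition inf_nat (R : realType) (P : set nat) : \bar R :=
  ereal_inf [set d%:R%:E | d in P].

Record coarseStructure (X : Type) := CoarseStructure {
  controlled : set (set (X * X));
  controlled_diagonal : controlled diagonal;
  controlled_subset : forall E F, F `<=` E -> controlled E -> controlled F;
  controlled_inv : forall E, controlled E -> controlled (E^-1)%relation;
  controlled_comp : forall E F, controlled E -> controlled F ->
    controlled (E \; F)%relation;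
  controlledU : forall E F, controlled E -> controlled F ->
    controlled (E `|` F) }.

(* The cover is given as the tuple of its subfamilies [W l], which may be
   empty and may overlap. *)
Definition asdim_at (X : Type) (CE : coarseStructure X) (d : nat) : Prop :=
  forall E, controlled CE E -> exists W : 'I_d.+1 -> set (set X),
    [/\ \bigcup_(A in \bigcup_l W l) A = [set: X],
        controlled CE (\bigcup_(A in \bigcup_l W l) (A `*` A)) &
        forall l A B, W l A -> W l B -> A <> B -> E `&` (A `*` B) = set0].

Definition asdim (R : realType) (X : Type) (CE : coarseStructure X) : \bar R :=
  inf_nat R (asdim_at CE).

(* Each [act g] is a homeomorphism, with inverse [act g^-1]. *)
Record topAction (G : groupType) (X : topologicalType) := TopAction {
  act :> G -> X -> X;
  act1 : forall x, act 1%g x = x;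
  actM : forall g h x, act (g * h)%g x = act g (act h x);
  act_continuous : forall g, continuous (act g) }.

Section orbit_coarse_structure.
Variables (G : groupType) (X : topologicalType) (alpha : topAction G X).

Definition orbit_rel (K : set X) (L : set G) : set (X * X) :=
  [set yx | exists2 g, L g & [/\ K yx.2, K yx.1 & yx.1 = alpha g yx.2]].

Definition orbit_controlled : set (set (X * X)) :=
  [set E | exists K L, [/\ compact K, finite_set L &
                           E `<=` orbit_rel K L `|` diagonal]].

Lemma orbit_diagonal : orbit_controlled diagonal.
Proof.
by exists set0, set0; split; [exact: compact0|exact: finite_set0|right].
Qed.

Lemma orbit_subset E F :
  F `<=` E -> orbit_controlled E -> orbit_controlled F.
Proof.
by move=> FE [K [L [cK fL EKL]]]; exists K, L; split=> //; apply: subset_trans EKL.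
Qed.

Lemma orbit_inv E : orbit_controlled E -> orbit_controlled (E^-1)%relation.
Proof.
move=> [K [L [cK fL EKL]]]; exists K, [set (g^-1)%g | g in L]; split=> //.
  exact: finite_image.
move=> [y x] /= /EKL [[g Lg /= [Ky Kx xE]]|]; last by rewrite /diagonal /=; right.
left; exists (g^-1)%g; first by exists g.
by split=> //=; rewrite xE -actM mulVg act1.
Qed.

Lemma orbit_comp E F : orbit_controlled E -> orbit_controlled F ->
  orbit_controlled (E \; F)%relation.
Proof.
move=> [K [L [cK fL EKL]]] [K' [L' [cK' fL' FKL]]].
exists (K `|` K'), ((L `|` L') `|` [set (g * h)%g | g in L' & h in L]).
split; first exact: compactU.
  by rewrite !finite_setU; split=> //; exact: finite_image2.
move=> [z x] /= [y /FKL + /EKL].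
move=> [[g Lg /= [Ky Kz zE]]|/diagonalP zy] [[h Lh /= [Kx Ky' yE]]|/diagonalP yx].
- left; exists (g * h)%g; first by right; exists g => //; exists h.
  by split=> /=; [left|right|rewrite actM -yE].
- rewrite -yx; left; exists g; first by left; right.
  by split=> /=; [right|right|].
- rewrite zy; left; exists h; first by left; left.
  by split=> /=; [left|left|].
- by right; rewrite zy yx.
Qed.

Lemma orbit_setU E F : orbit_controlled E -> orbit_controlled F ->
  orbit_controlled (E `|` F).
Proof.
move=> [K [L [cK fL EKL]]] [K' [L' [cK' fL' FKL]]].
exists (K `|` K'), (L `|` L').
split; [exact: compactU|by rewrite finite_setU|].
move=> [y x] [/EKL|/FKL] [[g Lg /= [Kx Ky yE]]|]; try by right.
- by left; exists g; [left|split=> //=; left].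
- by left; exists g; [right|split=> //=; right].
Qed.

Definition orbit_coarse : coarseStructure X :=
  CoarseStructure orbit_diagonal orbit_subset orbit_inv orbit_comp orbit_setU.

End orbit_coarse_structure.

Definition mult (R : realType) (X : topologicalType) (UU : set (set X)) :
    \bar R :=
  ereal_sup [set counting [set U | UU U /\ U x] | x in [set: X]].

Definition locally_constant_on (X : topologicalType) (Y : Type)
    (U : set X) (f : X -> Y) : Prop :=
  forall x, U x -> \forall y \near within U (nbhs x), f y = f x.

Definition finite_open_cover (X : topologicalType) (VV : set (set X)) : Prop :=
  [/\ finite_set VV, forall V, VV V -> open V & \bigcup_(V in VV) V = [set: X]].

Section LTC.
Variables (R : realType) (G : groupType) (X : topologicalType).
Variable alpha : topAction G X.

(* The maps U -> X are represented by total functions [Lam U] of which only the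
   values on [U] matter; the conjuncts of the conclusion are, in order: openness,
   local constancy, (Lo), (Mu), (Eq), (Th), (Ca). *)
Definition LTC_system (d : nat) (L : set G) (K : set X) (N : nat)
    (VV UU : set (set X)) (Lam : set X -> X -> X) : Prop :=
  (forall U, UU U -> open U) /\
  (forall U, UU U -> locally_constant_on U (Lam U)) /\
  [/\ forall x, K x -> exists2 U, UU U & [set alpha g x | g in L] `<=` U,
      mult R UU <= d.+1%:R%:E,
      forall U x g, UU U -> U x -> L g -> U (alpha g x) ->
        Lam U (alpha g x) = alpha g (Lam U x),
      forall U y, UU U -> (Lam U @` U) y -> exists2 V, VV V &
        (U `&` Lam U @^-1` [set y]) `|` [set y] `<=` V &
      forall U, UU U -> Lam U @` U #<= `I_N].

Definition dimLTC_at (d : nat) : Prop :=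
  forall (L : set G) (K : set X), finite_set L -> compact K ->
  exists N : nat, forall VV : set (set X), finite_open_cover VV ->
  exists (UU : set (set X)) (Lam : set X -> X -> X),
    LTC_system d L K N VV UU Lam.

Definition dimLTC : \bar R := inf_nat R dimLTC_at.

End LTC.

(* Main.v *)
(* Let [L] be a finite symmetric set of group elements containing 1 and [F] a
   finite set of points. If a finite open cover separates the points of [F], then
   for a long thin cover subordinate to it each [Lam U] is injective on
   [U `&` F] by (Th), so that [U `&` F] has at most [N] points by (Ca), where [N]
   does not depend on [F].
   Let the depth of [x] in [U] be the number of [k < d + 2] such that the [L^k]-orbit
   of [x] lies in [U]: it changes by at most one along an [L]-step, and is [d + 2]
   for some [U] by (Lo). By (Mu) some level between 1 and [d + 1] is not attained
   by the depths of [x]; colour [x] by such a level. A monochromatic chain of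
   [L]-steps stays in a single [U], hence has at most [N] points in [F].
   By compactness such a colouring with [d + 1] colours exists on all of [X], with
   the same [N], and the [L]-connected components of its colour classes form the
   required cover. Neither (Eq) nor the local constancy of [Lam U] matters: the
   cover of [X] carries no topology, which is what permits the passage to finite
   sets. *)

Require Import Defs.
From mathcomp Require Import all_boot all_order all_algebra.
From mathcomp Require Import all_classical all_reals all_analysis.
From mathcomp Require Import zify.

Import Order.TTheory GRing.Theory Num.Theory.

Local Open Scope classical_set_scope.
Local Open Scope ereal_scope.

(** * Counting and colourings *)

Lemma counting_ge_inj (R : realType) (T : choiceType) (n : nat) (A : set T)
    (u : 'I_n -> T) :
  injective u -> (forall i, A (u i)) -> n%:R%:E <= counting A :> \bar R.
Proof.
move=> u_inj uA; rewrite /counting.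
case: asboolP => [Afin|_]; last by rewrite leey.
rewrite lee_fin ler_nat -[X in (X <= _)%N]card_ord -(size_image u) /=.
apply: uniq_leq_size; first by rewrite map_inj_uniq ?enum_uniq.
by move=> t /mapP[i _ ->]; rewrite in_fset_set// inE.
Qed.

(** Take an ultrafilter that contains, for each finite [F0], the set of all finite [F] containing
    [F0], and let [c x] be the colour that almost all [F] give to [x]. A bad sequence is finite, so
    some finite [F] containing it colours it exactly as [c] does. *)
Lemma coloring_compactness (T : choiceType) (C : finType)
    (bad : set (seq T)) :
  (forall F : set T, finite_set F -> exists c : T -> C,
    forall s, bad s -> [set` s] `<=` F -> ~ constant (map c s)) ->
  exists c : T -> C, forall s, bad s -> ~ constant (map c s).
Proof.
move=> badF.
have /choice[cF cFP] : forall F : set T, exists c : T -> C, finite_set F ->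
    forall s, bad s -> [set` s] `<=` F -> ~ constant (map c s).
  move=> F; have [/badF[c cP]|Finf] := pselect (finite_set F).
    by exists c.
  by have [c _] := badF _ (finite_set0 T); exists c.
pose B : set_system (set T) := [set A | exists2 F0, finite_set F0 &
  forall F, finite_set F -> F0 `<=` F -> A F].
have B_proper : ProperFilter B.
  apply: Build_ProperFilter_ex.
    by move=> A [F0 F0f A0]; exists F0; exact: A0.
  split.
  - by exists set0.
  - move=> P Q [F0 f0 P0] [F1 f1 Q1]; exists (F0 `|` F1).
      by rewrite finite_setU; split.
    rewrite /= => F Ff; rewrite subUset => -[sF0 sF1]; split; first exact: P0.
    exact: Q1.
  - move=> P Q PQ [F0 f0 P0]; exists F0 => // F Ff sF.
    exact/PQ/P0.
have [U [U_ultra BU]] := ultraFilterLemma B_proper.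
(* As [C] is finite, the ultrafilter cannot exclude every colour at [x]. *)
have /choice[c cP] : forall x, exists l, U [set F | cF F x = l].
  move=> x; apply: contrapT => /forallNP noL.
  have /filter_forall/filter_ex [F /(_ (cF F x))] :
      forall l, \forall F \near U, cF F x <> l.
    by move=> l; have [/noL|] := in_ultra_setVsetC [set F | cF F x = l] U_ultra.
  by [].
exists c => s bs cs.
have Us : U [set F | finite_set F /\ [set` s] `<=` F].
  by apply/BU; exists [set` s]; [exact: finite_seq|split].
have Uc : \forall F \near U, forall x, x \in s -> cF F x = c x.
  elim: s {bs cs Us} => [|x s IH]; first exact: nearW.
  apply: filterS (filterI (cP x) IH) => F [/= Fx Fs] y.
  by rewrite inE => /predU1P[->|/Fs].
have [F [[Ff sF] Fc]] := filter_ex (filterI Us Uc).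
by apply: (cFP F Ff s bs sF); move/eq_in_map: Fc => ->.
Qed.

(* The colour of a point is a level in [1, d + 1] which none of the functions
   [f i] takes there; a path along which the [f i] vary by at most one cannot
   cross a level that is missed all along it. *)
Lemma missed_level_coloring (T : eqType) (I : Type) (d : nat) (e : rel T)
    (K : set T) (f : I -> T -> nat) :
  (forall x y, e x y -> K y) ->
  (forall i x y, e x y -> f i x <= (f i y).+1)%N ->
  (forall x, K x -> exists i, f i x = d.+2) ->
  (forall x (u : 'I_d.+2 -> I), injective u -> ~ forall j, (0 < f (u j) x)%N) ->
  exists c : T -> 'I_d.+1, forall x p, K x -> path e x p ->
    constant (map c (x :: p)) -> exists i, forall y, y \in x :: p -> (0 < f i y)%N.
Proof.
move=> eK f_lip f_top f_mult.
have /choice[c cP] : forall x, exists t : 'I_d.+1, K x -> forall i, f i x <> t.+1.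
  move=> x; have [Kx|] := pselect (K x); last by exists ord0.
  (* If the levels 1 to [d.+1] were all attained at [x], then together with [d.+2] from [f_top] they
     would give [d.+2] distinct indices positive at [x]. *)
  apply: contrapT => /forallNP all_hit.
  have /choice[u uP] : forall j : 'I_d.+2, exists i, f i x = j.+1.
    move=> j; have [jd|dj] := ltnP j d.+1.
      have /not_implyP[_ /existsNP[i /contrapT fi]] := all_hit (Ordinal jd).
      by exists i.
    have [i fi] := f_top x Kx; exists i; rewrite fi.
    by have := ltn_ord j; lia.
  apply: (f_mult x u) => [j k|j]; last by rewrite uP.
  by move=> ujk; apply: val_inj; apply: succn_inj; rewrite -!uP ujk.
exists c => x p Kx exp /= cp.
have [i fi] := f_top x Kx; exists i.
(* Invariant along the path: a value above the missed level drops by at most one per step, so it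
   never gets below without landing on it. *)
have : ((c x).+1 < f i x)%N by rewrite fi; have := ltn_ord (c x); lia.
elim: p x Kx exp cp {fi} => [|y p IH] x Kx /=.
  by move=> _ _ cfx z; rewrite inE => /eqP->; lia.
move=> /andP[exy eyp] /andP[/eqP cyx cp] cfx z.
rewrite inE => /predU1P[->|]; first by lia.
have Ky := eK _ _ exy.
apply: (IH y) => //; first by rewrite cyx.
by have := cP y Ky i; have := f_lip i _ _ exy; rewrite cyx; lia.
Qed.

(** * From colourings to covers *)

Lemma controlled_path (X : eqType) (CE : coarseStructure X) (e : rel X)
    (n : nat) :
  controlled CE [set xy | e xy.1 xy.2] ->
  exists2 E, controlled CE E &
    forall x p, path e x p -> (size p <= n)%N -> E (x, last x p).
Proof.
move=> eC; elim: n => [|n [E EC EP]].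
  by exists diagonal; [exact: controlled_diagonal|move=> x []].
exists ((E \; [set xy | e xy.1 xy.2])%relation `|` diagonal).
  apply: controlledU; last exact: controlled_diagonal.
  exact: controlled_comp.
move=> x [|y p] /=; first by right.
by move=> /andP[exy eyp] pn; left; exists y => //=; exact: EP.
Qed.

(** [W l] consists of the monochromatic [e]-components of colour [l]. Two points of a component are
    joined by a monochromatic path without repetitions, hence of at most [N] steps, which gives
    control. Points of the same colour related by [E] are equal or adjacent, so they share a
    component. *)
Lemma coloring_cover (X : eqType) (CE : coarseStructure X) (d N : nat)
    (E : set (X * X)) (e : rel X) (c : X -> 'I_d.+1) :
  controlled CE [set xy | e xy.1 xy.2] -> symmetric e ->
  E `<=` [set xy | e xy.1 xy.2] `|` diagonal ->
  (forall x p, path e x p -> uniq (x :: p) -> constant (map c (x :: p)) ->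
    (size p <= N)%N) ->
  exists W : 'I_d.+1 -> set (set X),
    [/\ \bigcup_(A in \bigcup_l W l) A = [set: X],
        controlled CE (\bigcup_(A in \bigcup_l W l) (A `*` A)) &
        forall l A B, W l A -> W l B -> A <> B -> E `&` (A `*` B) = set0].
Proof.
move=> eC e_sym Ee path_short.
pose ec := [rel x y | e x y && (c x == c y)].
pose comp x := [set y | exists2 p, path ec x p & last x p = y].
have comp_refl x : comp x x by exists [::].
have comp_trans x y z : comp x y -> comp y z -> comp x z.
  by move=> [p xp <-] [q yq <-]; exists (p ++ q); rewrite ?cat_path ?xp ?last_cat.
have ec_sym : symmetric ec by move=> x y /=; rewrite e_sym eq_sym.
have comp_sym x y : comp x y -> comp y x.
  move=> [p xp <-]; exists (rev (belast x p)).
    by rewrite rev_path (eq_path (e' := ec)) // => y z; exact: ec_sym.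
  by case: p {xp} => //= y' p; rewrite rev_cons last_rcons.
have comp_eq x y : comp x y -> comp x = comp y.
  move=> xy; apply/seteqP; split => z; last exact: comp_trans.
  exact/comp_trans/comp_sym.
have path_ec x p : path ec x p -> path e x p /\ all (pred1 (c x)) (map c p).
  elim: p x => //= y p IH x /andP[/andP[exy /eqP cxy] /IH[-> cp]].
  by rewrite exy cxy eqxx.
exists (fun l => [set comp x | x in [set x | c x = l]]); split.
- apply/seteqP; split=> // x _; exists (comp x) => //.
  by exists (c x) => //; exists x.
- have [E' EC' EP'] := controlled_path _ CE e N eC.
  apply: controlled_subset EC' => -[u v] [_ [l _ [a _ <-]]] /= [au av].
  have [p up <-] := comp_trans _ _ _ (comp_sym _ _ au) av.
  case/shortenP: up => q uq uniq_q _.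
  have [euq cq] := path_ec _ _ uq.
  by apply: EP' => //; exact: (path_short u).
- move=> l _ _ [a /= ca <-] [b /= cb <-] ab; apply/seteqP; split => // -[u v].
  move=> [/Ee Euv /= [au bv]]; apply: ab.
  rewrite (comp_eq _ _ au) (comp_eq _ _ bv); apply: comp_eq.
  case: Euv => [/= euv|/diagonalP->] //.
  have c_comp x y : comp x y -> c x = c y.
    move=> [p /path_ec[_ cp] <-]; apply/esym/eqP.
    case: (lastP p) cp => [//|q z]; rewrite map_rcons all_rcons last_rcons /=.
    by case/andP.
  exists [:: v] => //=.
  by rewrite euv -(c_comp _ _ au) -(c_comp _ _ bv) ca cb eqxx.
Qed.

(** Besides the complement of [F], the cover has for each [p] in [F] the complement of the rest of
    [F], which meets [F] in [p] alone. *)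
Lemma separating_finite_open_cover (X : topologicalType) (F : set X) :
  accessible_space X -> finite_set F ->
  exists2 VV, finite_open_cover VV &
    forall V x y, VV V -> F x -> F y -> V x -> V y -> x = y.
Proof.
move=> X_T1 Ffin.
have openC_fin (A : set X) : finite_set A -> open (~` A).
  move=> Afin; apply/closed_openC.
  exact: (accessible_finite_set_closed.1 X_T1).
exists ((~` F) |` [set ~` (F `\ p) | p in F]).
  split.
  - by rewrite finite_setU; split=> //; exact: finite_image.
  - move=> V [->|[p _ <-]].
      exact: openC_fin.
    exact/openC_fin/finite_setD.
  - apply/seteqP; split=> // x _; have [Fx|nFx] := pselect (F x).
      by exists (~` (F `\ x)); [right; exists x|case=> _; exact].
    by exists (~` F) => //; left.
move=> V x y [->//|[p _ <-]] Fx Fy Vx Vy.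
have eqp z : F z -> (~` (F `\ p)) z -> z = p.
  by move=> Fz nz; apply: contrapT => zp; exact: nz.
by rewrite (eqp x)// (eqp y).
Qed.

(** * Word sets and depth *)

Fixpoint word_set {G : groupType} (L : set G) (k : nat) : set G :=
  if k is k'.+1 then [set (h * g)%g | h in word_set L k' & g in L]
  else [set 1%g].

Lemma finite_word_set (G : groupType) (L : set G) (k : nat) :
  finite_set L -> finite_set (word_set L k).
Proof. by move=> Lfin; elim: k => //= k IH; exact: finite_image2. Qed.

Lemma word_set_le (G : groupType) (L : set G) (k m : nat) :
  L 1%g -> (k <= m)%N -> word_set L k `<=` word_set L m.
Proof.
move=> L1; elim: m => [|m IH]; first by rewrite leqn0 => /eqP->.
rewrite leq_eqVlt ltnS => /predU1P[->//|/IH km] g /km Lg.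
by exists g => //; exists 1%g => //; rewrite mulg1.
Qed.

Lemma word_set1 (G : groupType) (L : set G) (k : nat) :
  L 1%g -> word_set L k 1%g.
Proof. by move=> L1; exact: (@word_set_le _ _ 0%N). Qed.

Section depth.
Variables (G : groupType) (X : topologicalType) (alpha : topAction G X).
Variable L : set G.
Hypothesis L1 : L 1%g.

Definition depth (m : nat) (U : set X) (x : X) : nat :=
  (\sum_(k < m) `[< [set alpha g x | g in word_set L k] `<=` U >])%N.

Lemma depth_gt0 (m : nat) (U : set X) (x : X) : (0 < depth m U x)%N -> U x.
Proof.
move=> dx; apply: contrapT => nUx; move: dx; rewrite /depth big1// => k _.
case: asboolP => // /(_ x) Ux; exfalso; apply/nUx/Ux.
by exists 1%g; [exact: word_set1|exact: act1].
Qed.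

Lemma depth_eq_max (m : nat) (U : set X) (x : X) :
  [set alpha g x | g in word_set L m] `<=` U -> depth m.+1 U x = m.+1.
Proof.
move=> LxU; rewrite -[RHS]card_ord -sum1_card; apply: eq_bigr => k _.
rewrite asboolT//; apply: subset_trans LxU; apply: image_subset.
by apply: word_set_le; rewrite -1?ltnS.
Qed.

(** Words grow on the right, where the new factor acts first. Thus the orbit of [x] under words of
    length [k.+1] contains that of [alpha g x] under words of length [k], and shifting the sum costs
    only its term at 0. *)
Lemma depth_lip (m : nat) (U : set X) (g : G) (x : X) :
  L g -> (depth m U x <= (depth m U (alpha g x)).+1)%N.
Proof.
move=> Lg; case: m => [|m]; first by rewrite /depth big_ord0.
rewrite {1}/depth big_ord_recl -[leqRHS]add1n leq_add ?leq_b1//.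
rewrite /depth big_ord_recr/= (leq_trans _ (leq_addr _ _))//.
apply: leq_sum => k _; case: asboolP => // LxU; rewrite asboolT//.
move=> _ [h Lh <-]; apply: LxU; exists (h * g)%g; last by rewrite actM.
by exists h => //; exists g.
Qed.

End depth.

(** * From long thin covers to colourings *)

Lemma uniq_size_le_card (T : choiceType) (s : seq T) (A : set T) (n : nat) :
  uniq s -> [set` s] `<=` A -> (A #<= `I_n)%card -> (size s <= n)%N.
Proof.
move=> s_uniq sA An; apply: leq_trans (geq_card_fset_set An).
have Afin : finite_set A := card_le_finite An (finite_II n).
by apply: uniq_leq_size => // x xs; rewrite in_fset_set// inE; exact: sA.
Qed.

(* A cover [VV] separating the points of [F] makes [Lam U] injective on
   [U `&` F] by thinness, so that [U `&` F] has at most [N] points. *)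
Lemma dimLTC_at_coloring (R : realType) (G : groupType) (X : topologicalType)
    (alpha : topAction G X) (d : nat) (K : set X) (L : set G) :
  accessible_space X -> dimLTC_at R alpha d -> compact K -> finite_set L ->
  L 1%g ->
  let e := [rel x y | `[< orbit_rel alpha K L (y, x) >]] in
  exists N, forall F : set X, finite_set F -> exists c : X -> 'I_d.+1,
    forall x p, [set` x :: p] `<=` F -> path e x p -> uniq (x :: p) ->
      constant (map c (x :: p)) -> (size p <= N)%N.
Proof.
move=> X_T1 LTC Kc Lfin L1 e.
(* [d.+1] is the largest exponent among the [d.+2] terms of [depth], so (Lo) yields full depth. *)
have [N LTCN] := LTC _ K (finite_word_set _ L d.+1 Lfin) Kc.
exists N => F Ffin.
have [VV VVcover VVsep] := separating_finite_open_cover X F X_T1 Ffin.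
have [UU [Lam [_ [_ [Lo Mu _ Th Ca]]]]] := LTCN VV VVcover.
(* The value 0 off [UU] makes positivity imply membership in [UU], as (Mu) requires. *)
pose f U x := if `[< UU U >] then depth _ _ alpha L d.+2 U x else 0%N.
have fP U x : (0 < f U x)%N -> UU U /\ U x.
  by rewrite /f; case: asboolP => // UUU /(depth_gt0 _ _ _ _ L1).
have eK x y : e x y -> K x /\ K y by move=> /asboolP[g _ []].
have [||||c cP] := missed_level_coloring X (set X) d e K f.
- by move=> x y /eK[].
- move=> U x y /asboolP[g Lg [/= _ _ ->]]; rewrite /f; case: ifP => // _.
  exact: depth_lip.
- move=> x /Lo[U UUU LxU]; exists U; rewrite /f asboolT//.
  exact: depth_eq_max.
- move=> x u u_inj uP.
  have uA j : [set U | UU U /\ U x] (u j) := fP _ _ (uP j).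
  have xmult : counting [set U | UU U /\ U x] <= mult R UU.
    by apply: ereal_sup_ubound; exists x.
  have := le_trans (le_trans (counting_ge_inj R _ _ _ _ u_inj uA) xmult) Mu.
  by rewrite lee_fin ler_nat ltnn.
exists c => x [//|y p] xpF exp xp_uniq cxp.
have Kx : K x by move: exp => /= /andP[/eK[]].
have [U Uxp] := cP x (y :: p) Kx exp cxp.
have UUU : UU U by have [] := fP U x (Uxp x (mem_head _ _)).
have UP z : z \in x :: y :: p -> U z by move=> /Uxp/fP[].
(* (Ca) bounds the number of points of the path, one more than its number of steps. *)
apply: ltnW; rewrite -[(size _).+1]/(size (x :: y :: p)) -(size_map (Lam U)).
apply: uniq_size_le_card (Ca U UUU); last first.
  by move=> _ /mapP[z /UP Uz ->]; exists z.
rewrite map_inj_in_uniq// => z w zP wP Lzw.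
have [|V VVV thin] := Th U (Lam U z) UUU; first by exists z => //; exact: UP.
apply: (VVsep V) => //; [exact: xpF|exact: xpF|..]; apply: thin; left.
  by split; first exact: UP.
by split; first exact: UP.
Qed.

Lemma asdim_at_dimLTC_at (R : realType) (G : groupType) (X : topologicalType)
    (alpha : topAction G X) (d : nat) :
  accessible_space X -> dimLTC_at R alpha d -> asdim_at (orbit_coarse alpha) d.
Proof.
move=> X_T1 LTC E [K [L0 [Kc L0fin EKL0]]].
(* The unit makes the word sets increasing; the inverses make [e] symmetric. *)
pose L := 1%g |` (L0 `|` [set (g^-1)%g | g in L0]).
have Lfin : finite_set L.
  by rewrite !finite_setU; do !split=> //; exact: finite_image.
have Linv g : L g -> L (g^-1)%g.
  move=> [->|[Lg|[h Lh <-]]]; first by left; rewrite invg1.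
    by right; right; exists g.
  by right; left; rewrite invgK.
pose e := [rel x y | `[< orbit_rel alpha K L (y, x) >]].
have e_impl x y : e x y -> e y x.
  move=> /asboolP[g Lg [/= Kx Ky yE]]; apply/asboolP; exists (g^-1)%g.
    exact: Linv.
  by split=> //=; rewrite yE -actM mulVg act1.
have e_sym : symmetric e by move=> x y; apply/idP/idP; exact: e_impl.
have L1 : L 1%g by left.
have [N NP] := dimLTC_at_coloring R G X alpha d K L X_T1 LTC Kc Lfin L1.
(* As [N] is chosen before [F], the same bad sequences serve for all finite [F], and compactness
   applies. *)
pose bad := [set s | exists x p,
  [/\ s = x :: p, path e x p, uniq (x :: p) & (N < size p)%N]].
have [F Ffin|c cP] := coloring_compactness X 'I_d.+1 bad.
  have [c cP] := NP F Ffin; exists c => _ [x [p [-> exp xp_uniq Np]]] xpF cxp.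
  by have := cP x p xpF exp xp_uniq cxp; rewrite leqNgt Np.
apply: (coloring_cover X _ d N E e c) => //.
- exists K, L; split=> // -[x y] /= /e_impl/asboolP exy.
  by left.
- move=> [x y] /EKL0[[g Lg [/= Ky Kx xE]]|]; last by right.
  left; apply: e_impl; apply/asboolP; exists g => //.
  by right; left.
- move=> x p exp xp_uniq cxp; rewrite leqNgt; apply/negP => Np.
  by apply: (cP (x :: p)) => //; exists x, p.
Qed.

Theorem theorem6p1 (R : realType) (G : groupType) (X : topologicalType)
    (X_lc : locally_compact [set: X]) (X_T2 : hausdorff_space X)
    (alpha : topAction G X) :
  asdim R (orbit_coarse alpha) <= dimLTC R alpha.
Proof.
apply: ereal_inf_le_tmp => _ [d LTC <-]; exists d => //.
exact: asdim_at_dimLTC_at (hausdorff_accessible X_T2) LTC.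
Qed.
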